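(* Let $n\ge1$ and $k\ge1$ be integers. Let $\Upsilon_1=\{(1\text{-}2,0~0),(2\text{-}1,0~0)\}$, $\Upsilon_2=\{(1\text{-}2,1~0),(2\text{-}1,1~0)\}$, $\Upsilon_3=\{(1\text{-}2,0~0),(1\text{-}2,1~0),(2\text{-}1,0~0),(2\text{-}1,1~0)\}$, $\Upsilon_4=\{(1\text{-}2,0~1),(1\text{-}2,1~0),(2\text{-}1,0~1),(2\text{-}1,1~0)\}$. Then (1) $Av_{n,k}^{\Upsilon_1}=\binom{k}{n}\,n!\,n!$; (2) $Av_{n,k}^{\Upsilon_2}=\binom{n+k-1}{n}\,n!$; (3) $Av_{n,k}^{\Upsilon_3}=\binom{k}{n}\,n!$; (4) $Av_{n,k}^{\Upsilon_4}=k\,n!$.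
   Context: For integers $k\ge1$, $n\ge0$, $C_k\wr S_n$ denotes the set of pairs $(\sigma,w)$ where $\sigma=\sigma_1\cdots\sigma_n$ is a permutation of $\{1,\dots,n\}$ in one-line notation and $w=w_1\cdots w_n\in\{0,1,\dots,k-1\}^n$. For a sequence of distinct integers, $\mathrm{red}$ replaces the $i$-th smallest entry by $i$; for a word over nonnegative integers, $\mathrm{red}$ replaces every occurrence of the $i$-th smallest distinct letter by $i-1$. A pattern $(\tau,u)$ has $\tau\in S_j$ and $u$ a word of length $j$ with $\mathrm{red}(u)=u$; e.g. $(2\text{-}1,1~0)$ means $\tau=21$, $u=10$. $(\tau,u)$ bi-occurs in $(\sigma,w)$ if there are $1\le i_1<\cdots<i_j\le n$ (not necessarily adjacent) with $\mathrm{red}(\sigma_{i_1}\cdots\sigma_{i_j})=\tau$ and $\mathrm{red}(w_{i_1}\cdots w_{i_j})=u$. $(\sigma,w)$ bi-avoids a set of patterns if no pattern of the set bi-occurs in it. $Av_{n,k}^{\Upsilon}$ denotes the number of elements of $C_k\wr S_n$ bi-avoiding the set $\Upsilon$. Here $\binom{k}{n}=0$ when $n>k$. *)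

(* Defs.v *)
From mathcomp Require Import all_boot all_fingroup.

Set Implicit Arguments.
Unset Strict Implicit.
Unset Printing Implicit Defensive.

(* A pair (s, w); positions, values and letters are 0-based in the types, so
   the one-line notation s_1 ... s_n has entries (s i).+1 with i : 'I_n. *)
Definition wreath (k n : nat) : Type := ('S_n * {ffun 'I_n -> 'I_k})%type.

(* For a sequence of distinct integers; smallest entry becomes 1. *)
Definition red_perm (s : seq nat) : seq nat :=
  [seq (index x (sort leq s)).+1 | x <- s].

(* For a word, possibly with repeated letters; smallest letter becomes 0. *)
Definition red_word (w : seq nat) : seq nat :=
  [seq index x (sort leq (undup w)) | x <- w].

Definition is_pattern (t u : seq nat) : bool :=
  [&& perm_eq t (iota 1 (size t)), size u == size t & red_word u == u].

Record pattern : Type := Pattern {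
  pat_perm : seq nat;
  pat_word : seq nat;
  _ : is_pattern pat_perm pat_word
}.

Definition bi_occurs (n k : nat) (p : pattern) (x : wreath k n) : bool :=
  [exists i : (size (pat_perm p)).-tuple 'I_n,
    [&& sorted (fun a b : 'I_n => a < b) i,
        red_perm [seq (x.1 a).+1 | a <- i] == pat_perm p
      & red_word [seq nat_of_ord (x.2 a) | a <- i] == pat_word p]].

(* A finite set of patterns is given by a list of its elements. *)
Definition bi_avoids (n k : nat) (Y : seq pattern) (x : wreath k n) : bool :=
  all (fun p => ~~ bi_occurs p x) Y.

Definition Av (n k : nat) (Y : seq pattern) : nat :=
  #|[set x : wreath k n | bi_avoids Y x]|.

Definition p12_00 : pattern := @Pattern [:: 1; 2] [:: 0; 0] isT.
Definition p12_01 : pattern := @Pattern [:: 1; 2] [:: 0; 1] isT.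
Definition p12_10 : pattern := @Pattern [:: 1; 2] [:: 1; 0] isT.
Definition p21_00 : pattern := @Pattern [:: 2; 1] [:: 0; 0] isT.
Definition p21_01 : pattern := @Pattern [:: 2; 1] [:: 0; 1] isT.
Definition p21_10 : pattern := @Pattern [:: 2; 1] [:: 1; 0] isT.

Definition Upsilon1 : seq pattern := [:: p12_00; p21_00].
Definition Upsilon2 : seq pattern := [:: p12_10; p21_10].
Definition Upsilon3 : seq pattern := [:: p12_00; p12_10; p21_00; p21_10].
Definition Upsilon4 : seq pattern := [:: p12_01; p12_10; p21_01; p21_10].

(* Main.v *)
Require Import Defs.
From mathcomp Require Import all_boot all_fingroup.

(* Each of the four sets contains (12, u) if and only if it contains (21, u), so
   avoiding it constrains the word alone: the letters w_a, w_b at positions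
   a < b must be related by !=, <=, < and == respectively. Every such word is
   paired with all n! permutations, and the words are respectively injective,
   weakly increasing, strictly increasing and constant. *)

Lemma red_perm2 (s t : nat) :
  s != t -> red_perm [:: s; t] = if s < t then [:: 1; 2] else [:: 2; 1].
Proof.
rewrite /red_perm /sort /=.
by case: ltngtP => //= st _; rewrite !eqxx (ltn_eqF st).
Qed.

Lemma red_word2 (c d : nat) :
  red_word [:: c; d] =
    if c < d then [:: 0; 1] else if c == d then [:: 0; 0] else [:: 1; 0].
Proof.
rewrite /red_word /sort /= inE.
case: (ltngtP c d) => [cd|cd|->] /=; last by rewrite eqxx.
  by rewrite (ltnW cd) /= !eqxx (ltn_eqF cd).
by rewrite leqNgt cd /= !eqxx (ltn_eqF cd).
Qed.

Definition rel_word {n k : nat} (r : rel nat) (w : {ffun 'I_n -> 'I_k}) : bool :=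
  [forall a : 'I_n, forall b : 'I_n, (a < b) ==> r (w a) (w b)].

Lemma rel_wordP {n k : nat} {r : rel nat} {w : {ffun 'I_n -> 'I_k}} :
  reflect (forall a b : 'I_n, a < b -> r (w a) (w b)) (rel_word r w).
Proof.
apply: (iffP forallP) => [h a b ab|h a].
  by move/forallP: (h a) => /(_ b) /implyP; apply.
by apply/forallP => b; apply/implyP; apply: h.
Qed.

Lemma bi_occurs2P {n k : nat} {p : pattern} {x : wreath k n} :
  size (pat_perm p) = 2 ->
  reflect (exists a b : 'I_n,
    [/\ a < b, red_perm [:: (x.1 a).+1; (x.1 b).+1] = pat_perm p
      & red_word [:: nat_of_ord (x.2 a); nat_of_ord (x.2 b)] = pat_word p])
  (bi_occurs p x).
Proof.
move=> sz; apply: (iffP existsP) => [[i]|[a [b [ab eqt equ]]]].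
  have: size i = 2 by rewrite size_tuple.
  case: (tval i) => [|a [|b [|]]] //= _; rewrite andbT.
  by case/and3P=> ab /eqP eqt /eqP equ; exists a, b.
(* The tuple type has length [size (pat_perm p)], equal to 2 only propositionally, so the pair is
   packed with an explicit size proof. *)
have szab : size [:: a; b] == size (pat_perm p) by rewrite sz.
by exists (Tuple szab); rewrite /= ab eqt equ !eqxx.
Qed.

(** Since [r c d] does not mention [s] and [t], the second hypothesis says that [Y] forbids the same
    two-letter words in ascents and in descents. The avoiding pairs then form a full product. *)
Lemma Av_rel_word (n k : nat) (Y : seq pattern) (r : rel nat) :
  all (fun p => size (pat_perm p) == 2) Y ->
  (forall s t c d, s != t ->
     r c d = all (fun p => ~~ ((red_perm [:: s; t] == pat_perm p)
                               && (red_word [:: c; d] == pat_word p))) Y) ->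
  Av n k Y = #|[set w : {ffun 'I_n -> 'I_k} | rel_word r w]| * n`!.
Proof.
(* [pattern] is not an [eqType], so members of [Y] are handled by index. *)
move=> /(all_nthP p12_00) szY rY.
have neq (s : 'S_n) (a b : 'I_n) : a < b -> (s a).+1 != (s b).+1.
  by move=> ab; rewrite eqSS (inj_eq val_inj) (inj_eq perm_inj) neq_ltn ab.
have avoidE (x : wreath k n) : bi_avoids Y x = rel_word r x.2.
  apply/(all_nthP p12_00)/rel_wordP => [av a b ab|h i iY].
    rewrite (rY _ _ _ _ (neq x.1 _ _ ab)); apply/(all_nthP p12_00) => i iY.
    apply: contra (av i iY) => /andP[/eqP eqt /eqP equ].
    by apply/(bi_occurs2P (eqP (szY i iY))); exists a, b.
  apply/negP => /(bi_occurs2P (eqP (szY i iY))) [a [b [ab eqt equ]]].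
  have := h a b ab; rewrite (rY _ _ _ _ (neq x.1 _ _ ab)).
  by move/(all_nthP p12_00)/(_ i iY); rewrite eqt equ !eqxx.
rewrite /Av mulnC -(card_Sn n) -cardsT -cardsX.
by apply: eq_card => -[s w]; rewrite !inE avoidE.
Qed.

(** As [!=] is symmetric, testing it for [a < b] already gives injectivity. *)
Lemma card_rel_word_neq (n k : nat) :
  #|[set w : {ffun 'I_n -> 'I_k} | rel_word (fun c d => c != d) w]| = k ^_ n.
Proof.
rewrite -[k in RHS]card_ord -[n in RHS]card_ord -card_inj_ffuns.
apply: eq_card => w; rewrite !inE.
apply/rel_wordP/injectiveP => [h a b /(congr1 val) /= ab|inj a b ab].
  apply/val_inj; case: (ltngtP a b) => // [/h|/h]; by rewrite ab eqxx.
by rewrite (inj_eq val_inj) (inj_eq inj) neq_ltn ab.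
Qed.

(** Transitivity reduces all pairs [a < b] to adjacent ones; this gives access to the known counts
    of sorted tuples. *)
Lemma card_rel_word_sorted (n k : nat) (r : rel nat) : transitive r ->
  #|[set w : {ffun 'I_n -> 'I_k} | rel_word r w]| =
  #|[set t : n.-tuple 'I_k | sorted r (map val t)]|.
Proof.
move=> r_tr.
pose word (t : n.-tuple 'I_k) := [ffun i => tnth t i].
have word_bij : bijective word.
  exists (fun w : {ffun 'I_n -> 'I_k} => [tuple w i | i < n]) => [t|w].
    by apply: eq_from_tnth => i; rewrite tnth_mktuple ffunE.
  by apply/ffunP => i; rewrite ffunE tnth_mktuple.
rewrite -(on_card_preimset (onW_bij _ word_bij)).
apply: eq_card => t; rewrite !inE sorted_pairwise //.
have nthE (i : 'I_n) : nth 0 (map val t) i = word t i.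
  by rewrite ffunE -tnth_map (tnth_nth 0).
apply/rel_wordP/(pairwiseP 0) => [h i j|h a b ab].
  rewrite !inE size_map size_tuple => ltin ltjn ij.
  by have := h (Ordinal ltin) (Ordinal ltjn) ij; rewrite -!nthE.
by rewrite -!nthE; apply: h; rewrite // inE size_map size_tuple.
Qed.

Lemma card_rel_word_eq (n k : nat) : 0 < n ->
  #|[set w : {ffun 'I_n -> 'I_k} | rel_word (fun c d => c == d) w]| = k.
Proof.
case: n => // n _.
pose const (c : 'I_k) : {ffun 'I_n.+1 -> 'I_k} := [ffun=> c].
have const_inj : injective const by move=> c d /ffunP /(_ ord0); rewrite !ffunE.
rewrite -[RHS]card_ord -cardsT -(card_imset _ const_inj).
apply: eq_card => w; rewrite inE.
apply/rel_wordP/imsetP => [h|[c _ ->] a b _]; last by rewrite !ffunE.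
exists (w ord0) => //; apply/ffunP => a; rewrite ffunE; apply/val_inj.
(* [h] compares position 0 only with later positions, so [a = 0] is treated apart. *)
case: (posnP a) => [a0|a_gt0]; last exact/esym/eqP/h.
by congr (val (w _)); apply/val_inj.
Qed.

Theorem theorem4 (n k : nat) (hn : 1 <= n) (hk : 1 <= k) :
  [/\ Av n k Upsilon1 = 'C(k, n) * n`! * n`!,
      Av n k Upsilon2 = 'C(n + k - 1, n) * n`!,
      Av n k Upsilon3 = 'C(k, n) * n`!
    & Av n k Upsilon4 = k * n`!].
Proof.
split.
(* One factorial joins the binomial to form [k ^_ n]; the other counts the permutations. *)
- rewrite bin_ffact -card_rel_word_neq; apply: Av_rel_word => // s t c d st.
  by rewrite /= red_perm2 // red_word2; case: (s < t); case: ltngtP.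
(* The count of weakly sorted tuples is stated for an alphabet ['I_k.+1], hence the shift of [k]. *)
- case: k hk => // k _; rewrite addnS subn1 /= -card_sorted_tuples.
  rewrite -card_rel_word_sorted; last exact: leq_trans.
  apply: Av_rel_word => // s t c d st.
  by rewrite /= red_perm2 // red_word2; case: (s < t); case: ltngtP.
- rewrite -card_ltn_sorted_tuples -card_rel_word_sorted; last exact: ltn_trans.
  apply: Av_rel_word => // s t c d st.
  by rewrite /= red_perm2 // red_word2; case: (s < t); case: ltngtP.
- rewrite -[in RHS](card_rel_word_eq n k hn); apply: Av_rel_word => // s t c d st.
  by rewrite /= red_perm2 // red_word2; case: (s < t); case: ltngtP.
Qed.
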